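(* Let $\mathfrak{g}=\mathfrak{p}^A\frac{a_1|\cdots|a_m|1}{b_1|\cdots|b_t}$ be a Frobenius type-A seaweed with spectrum $S$, and let $r\ge 1$. Then (1) $\mathfrak{g}'=\mathfrak{p}^A\frac{a_1|\cdots|a_m|2|\cdots|2}{b_1|\cdots|b_t|2|\cdots|2|1}$, with $r$ parts equal to $2$ appended on top and $r-1$ parts equal to $2$ followed by a part $1$ appended on the bottom, is a Frobenius type-A seaweed with spectrum $S\cup\{0^{2r-1},1^{2r-1}\}$; and (2) $\mathfrak{g}''=\mathfrak{p}^A\frac{a_1|\cdots|a_m|2|\cdots|2|1}{b_1|\cdots|b_t|2|\cdots|2}$, with $r$ parts equal to $2$ followed by a part $1$ appended on top and $r$ parts equal to $2$ appended on the bottom, is a Frobenius type-A seaweed with spectrum $S\cup\{0^{2r},1^{2r}\}$.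
   Context: Type-A seaweeds: for compositions $\underline a=(a_1,\dots,a_m)$ and $\underline b=(b_1,\dots,b_t)$ of $n$, let $e_1,\dots,e_n$ be a basis of $V=\mathbb{C}^n$, $V_i=\mathrm{span}\{e_1,\dots,e_{a_1+\dots+a_i}\}$ and $W_j=\mathrm{span}\{e_{b_1+\dots+b_j+1},\dots,e_n\}$. The type-A seaweed $\mathfrak{p}^A\frac{a_1|\cdots|a_m}{b_1|\cdots|b_t}$ is the subalgebra of $\mathfrak{sl}(n)$ of matrices preserving both flags $0\subset V_1\subset\dots\subset V_m=V$ and $V=W_0\supset W_1\supset\dots\supset W_t=0$ (here both rows of the fraction are compositions of the same $n$). A Lie algebra $\mathfrak{g}$ is Frobenius if there is $F\in\mathfrak{g}^*$ with $(x,y)\mapsto F([x,y])$ nondegenerate; then there is a unique $\widehat F\in\mathfrak{g}$ with $F([\widehat F,x])=F(x)$ for all $x$, and the spectrum of $\mathfrak{g}$ is the multiset of eigenvalues of $\mathrm{ad}\,\widehat F$ on $\mathfrak{g}$ (independent of the choice of Frobenius $F$). Notation: $\{x^k\}$ denotes $x$ with multiplicity $k$, and $\cup$ denotes multiset union (multiplicities add). *)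

(* Defs.v *)
From HB Require Import structures.
From mathcomp Require Import all_boot all_order all_algebra.
From mathcomp Require Import finmap multiset.

Set Implicit Arguments.
Unset Strict Implicit.
Unset Printing Implicit Defensive.

Import GRing.Theory.
Local Open Scope ring_scope.

Section LinearLieAlgebras.
Variables (K : fieldType) (n : nat).
Implicit Types (A B : 'M[K]_n) (g : {vspace 'M[K]_n}).

Definition commutator A B : 'M[K]_n := A *m B - B *m A.

Definition lie_closed g : Prop :=
  forall A B, A \in g -> B \in g -> commutator A B \in g.

(* The bracket of g as an operation on the type of elements of g.  vsproj only
   casts the commutator back into g: it changes nothing as soon as g is closed
   under commutators (lemma val_lie below). *)
Definition lie g (x y : subvs_of g) : subvs_of g :=
  vsproj g (commutator (vsval x) (vsval y)).

Definition ad g (x : subvs_of g) : 'End(subvs_of g) := linfun (lie x).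

(* Nondegeneracy of (x, y) |-> F [x, y]; this form is alternating, so its left
   radical is its radical. *)
Definition frobenius_form g (F : 'Hom(subvs_of g, K^o)) : Prop :=
  forall x, (forall y, F (lie x y) = 0) -> x = 0.

Definition frobenius g : Prop :=
  exists F : 'Hom(subvs_of g, K^o), frobenius_form F.

Definition principal_element g (F : 'Hom(subvs_of g, K^o)) (x : subvs_of g) :
  Prop := forall y, F (lie x y) = F y.

Lemma val_lie g (x y : subvs_of g) : lie_closed g ->
  vsval (lie x y) = commutator (vsval x) (vsval y).
Proof. by move=> gP; rewrite vsprojK // gP ?subvsP. Qed.

Lemma lie_is_linear g (x : subvs_of g) : linear (lie x).
Proof.
move=> c y z; rewrite /lie -linearP /=; congr vsproj; rewrite /commutator /=.
rewrite mulmxDr mulmxDl -scalemxAr -scalemxAl scalerBr opprD.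
by rewrite addrACA.
Qed.

Lemma adE g (x y : subvs_of g) : ad x y = lie x y.
Proof.
pose f := GRing.isLinear.Build _ _ _ _ (lie x) (@lie_is_linear g x).
pose h : {linear subvs_of g -> subvs_of g} := HB.pack (lie x) f.
by rewrite /ad (lfunE h).
Qed.

Lemma principal_element_uniq g (F : 'Hom(subvs_of g, K^o)) x x' :
  frobenius_form F -> principal_element F x -> principal_element F x' ->
  x = x'.
Proof.
move=> nF Fx Fx'; apply/eqP; rewrite -subr_eq0; apply/eqP/nF => y.
suff -> : lie (x - x') y = lie x y - lie x' y by rewrite linearB /= Fx Fx' subrr.
rewrite /lie -linearB /=; congr vsproj; rewrite /commutator mulmxBl mulmxBr.
by rewrite !opprD !opprK addrACA.
Qed.

End LinearLieAlgebras.

(* S is the multiset of eigenvalues of f, counted with algebraic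
   multiplicity. *)
Definition eigenvalue_multiset (K : fieldType) (L : vectType K) (f : 'End(L))
    (S : {mset K}%mset) : Prop :=
  let e := vbasis {:L} in
  forall z : K, S z = mup z (char_poly (passmx.mxof e e f)).

(* Every Frobenius form of g gives the spectrum S: the spectrum does not depend
   on the choice of the form. *)
Definition has_spectrum (K : fieldType) (n : nat) (g : {vspace 'M[K]_n})
    (S : {mset K}%mset) : Prop :=
  forall F : 'Hom(subvs_of g, K^o), frobenius_form F ->
  exists2 x : subvs_of g,
    principal_element F x & eigenvalue_multiset (ad x) S.

Section Seaweeds.
Variable K : fieldType.

Definition composition (n : nat) (a : seq nat) : bool :=
  all (leq 1) a && (sumn a == n).

Definition initial_span (n k : nat) : {vspace 'cV[K]_n} :=
  <<[seq (delta_mx i ord0 : 'cV[K]_n) | i : 'I_n <- enum 'I_n & (i < k)%N]>>%VS.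

Definition final_span (n k : nat) : {vspace 'cV[K]_n} :=
  <<[seq (delta_mx i ord0 : 'cV[K]_n) | i : 'I_n <- enum 'I_n & (k <= i)%N]>>%VS.

(* The matrices A with A U contained in U; this is tested on a basis of U, see
   mem_stabilizer. *)
Definition stabilizer (n : nat) (U : {vspace 'cV[K]_n}) : {vspace 'M[K]_n} :=
  (\bigcap_(v <- vbasis U) (linfun (fun A : 'M[K]_n => A *m v) @^-1: U))%VS.

Definition traceless (n : nat) : {vspace 'M[K]_n} :=
  lker (linfun (fun A : 'M[K]_n => \tr A : K^o)).

(* The top row a fixes the size of the matrices; b is meant to be a composition
   of the same integer. *)
Definition seaweed (a b : seq nat) : {vspace 'M[K]_(sumn a)} :=
  (traceless (sumn a)
   :&: (\bigcap_(i < (size a).+1)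
          stabilizer (initial_span (sumn a) (sumn (take i a))))
   :&: (\bigcap_(j < (size b).+1)
          stabilizer (final_span (sumn a) (sumn (take j b)))))%VS.

Lemma mem_bigcap_vs (vT : vectType K) (I : eqType) (r : seq I)
    (P : I -> {vspace vT}) u :
  reflect (forall i, i \in r -> u \in P i) (u \in \bigcap_(i <- r) P i)%VS.
Proof.
elim: r => [|j r IH]; first by rewrite big_nil memvf; constructor.
rewrite big_cons memv_cap; apply: (iffP andP) => [[uj /IH ur] i|ur].
  by rewrite inE => /orP[/eqP->|/ur].
split; first by rewrite ur ?mem_head.
by apply/IH => i ir; rewrite ur // inE ir orbT.
Qed.

Lemma mem_stabilizer n (U : {vspace 'cV[K]_n}) (A : 'M[K]_n) :
  reflect (forall v, v \in U -> A *m v \in U) (A \in stabilizer U).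
Proof.
have E v : linfun (fun B : 'M[K]_n => B *m v) A = A *m v.
  exact: (lfunE (mulmxr v)).
apply: (iffP (mem_bigcap_vs _ _ _)) => [AU v /coord_vbasis ->|AU v vU].
  rewrite mulmx_sumr memv_suml // => i _; rewrite -scalemxAr memvZ //.
  by have /AU := mem_tnth i (vbasis U); rewrite -memv_preim E (tnth_nth 0).
by rewrite -memv_preim E AU // vbasis_mem.
Qed.

Lemma mem_traceless n (A : 'M[K]_n) : (A \in traceless n) = (\tr A == 0).
Proof. by rewrite memv_ker (lfunE (@mxtrace K n : {linear 'M[K]_n -> K^o})). Qed.

Lemma mem_seaweed a b (A : 'M[K]_(sumn a)) :
  reflect
    [/\ \tr A = 0,
        forall i, (i <= size a)%N -> forall v,
          v \in initial_span (sumn a) (sumn (take i a)) ->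
          A *m v \in initial_span (sumn a) (sumn (take i a))
      & forall j, (j <= size b)%N -> forall v,
          v \in final_span (sumn a) (sumn (take j b)) ->
          A *m v \in final_span (sumn a) (sumn (take j b))]
    (A \in seaweed a b).
Proof.
rewrite !memv_cap mem_traceless -andbA; apply: (iffP and3P) => [[]|[tA aA bA]].
  move=> /eqP tA /mem_bigcap_vs aA /mem_bigcap_vs bA; split=> // i le_i.
    by apply/mem_stabilizer/(aA (Ordinal (le_i : i < (size a).+1)%N))/mem_index_enum.
  by apply/mem_stabilizer/(bA (Ordinal (le_i : i < (size b).+1)%N))/mem_index_enum.
split; first exact/eqP.
  by apply/mem_bigcap_vs => i _; apply/mem_stabilizer/aA; rewrite -ltnS.
by apply/mem_bigcap_vs => i _; apply/mem_stabilizer/bA; rewrite -ltnS.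
Qed.

Lemma seaweed_lie_closed a b : lie_closed (seaweed a b).
Proof.
move=> A B /mem_seaweed[_ aA bA] /mem_seaweed[_ aB bB]; apply/mem_seaweed.
split=> [|i le_i v vV|j le_j v vW].
- by rewrite /commutator linearB /= mxtrace_mulC subrr.
- by rewrite mulmxBl -!mulmxA memvB ?(aA, aB).
- by rewrite mulmxBl -!mulmxA memvB ?(bA, bB).
Qed.

End Seaweeds.

Definition frobenius_seaweed_with_spectrum (K : fieldType) (a b : seq nat)
    (S : {mset K}%mset) : Prop :=
  [/\ composition (sumn a) a, composition (sumn a) b,
      frobenius (seaweed K a b) & has_spectrum (seaweed K a b) S].

(* Main.v *)
Require Import Defs.
From HB Require Import structures.
From mathcomp Require Import all_boot all_order all_algebra.
From mathcomp Require Import finmap multiset complex reals.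
From mathcomp Require Import ring zify.
Import GRing.Theory passmx.
Local Open Scope ring_scope.

Set Implicit Arguments.
Unset Strict Implicit.
Unset Printing Implicit Defensive.

(* A seaweed consists of the traceless matrices supported on a preorder of the
   indices.  Passing from a|1 over b to a|2 over b|1 adds one index n and one
   off-diagonal position (n, n-1), where n-1 is a sink of the old preorder;
   passing from a over b|1 to a|1 over b|2 adds the position (l, n), where l is
   a source.  The claim follows by alternating these two steps.

   In both cases g' = g + <h> + <e> with [h, g] = 0, [h, e] = e and
   [x, e] = chi(x) e for a character chi of g.  A form F' on g' is Frobenius
   iff F'(e) <> 0 and its restriction to g is Frobenius.  Its principal element
   is x + (1 - chi(x)) h - (F'(h) / F'(e)) e, where x is principal for
   F' - F'(h) chi on g.  Its adjoint action is triangular along <e>, g' / <e>,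
   with eigenvalue 1 on e, 0 on h, and ad x on g. *)

(** * Characteristic polynomials under a triangular extension *)

(** [P] intertwines the characteristic matrices too, and its nonzero determinant cancels. Two sizes
    are allowed because the dimension of an extension is not syntactically that of the old space
    plus two. *)
Lemma char_poly_intertwine (K : fieldType) m1 m2 (A : 'M[K]_m1) (B : 'M[K]_m2)
    (P : 'M[K]_(m1, m2)) :
  row_free P -> row_full P -> P *m B = A *m P -> char_poly A = char_poly B.
Proof.
move=> /eqP freeP /eqP fullP; have Em : m1 = m2 by rewrite -freeP fullP.
subst m2 => PBAP.
have uP : P \in unitmx by rewrite -row_free_unit /row_free freeP.
have /(congr1 determinant) : map_mx polyC P *m char_poly_mx B =
    char_poly_mx A *m map_mx polyC P.
  by rewrite /char_poly_mx mulmxBr mulmxBl -!map_mxM PBAP scalar_mxC.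
rewrite !det_mulmx [RHS]mulrC => /esym/mulfI; apply.
by rewrite det_map_mx polyC_eq0 -unitfE -unitmxE.
Qed.

Lemma char_poly_ublock (K : fieldType) m1 m2 (A : 'M[K]_m1) B (D : 'M[K]_m2) :
  char_poly (block_mx A B 0 D) = char_poly A * char_poly D.
Proof.
rewrite /char_poly /char_poly_mx map_block_mx map_mx0 scalar_mx_block.
by rewrite opp_block_mx add_block_mx oppr0 addr0 det_ublock.
Qed.

(** In the basis formed by the image of a basis of [L], then [h], then [e], the matrix of [f'] is
    block upper triangular in the row-vector convention. Its diagonal blocks are the matrix of [f]
    and a 2 by 2 triangular block with diagonal 0, 1. *)
Lemma char_poly_extension (K : fieldType) (L L' : vectType K)
    (f : 'End(L)) (f' : 'End(L')) (iota : 'Hom(L, L')) (h e : L')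
    (c : L -> K) (c0 : K) :
  (forall x s t, iota x + s *: h + t *: e = 0 -> [/\ x = 0, s = 0 & t = 0]) ->
  (forall y, exists x s t, y = iota x + s *: h + t *: e) ->
  (forall x, f' (iota x) = iota (f x) + c x *: e) ->
  f' h = c0 *: e -> f' e = e ->
  char_poly (mxof (vbasis {:L'}) (vbasis {:L'}) f') =
  char_poly (mxof (vbasis {:L}) (vbasis {:L}) f) * ('X * ('X - 1%:P)).
Proof.
move=> inj surj f'iota f'h f'e.
have bL := vbasisP {:L}; have bL' := vbasisP {:L'}.
set b' := vbasis {:L'} in bL' *; set b := vbasis {:L} in bL *.
pose I := mxof b b' iota.
pose rh := rVof b' h; pose re := rVof b' e.
(* The rows of [T] are the coordinates in [b'] of the adapted basis, so [T] is the change of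
   basis. *)
pose T := col_mx I (col_mx rh re).
have TE u s t : row_mx u (row_mx s t) *m T =
    rVof b' (iota (vecof b u) + s 0 0 *: h + t 0 0 *: e).
  rewrite !mul_row_col mul_mxof /= addrA.
  rewrite [RHS]linearD [in RHS]linearD !linearZ /=.
  by rewrite {1}[s]mx11_scalar {1}[t]mx11_scalar !mul_scalar_mx.
have -> : 'X * ('X - 1%:P) =
    char_poly (block_mx (0 : 'M[K]_1) c0%:M 0 (1%:M : 'M[K]_1)).
  rewrite char_poly_ublock !char_poly_trig ?mx0_is_trig ?scalar_mx_is_trig //.
  by rewrite !big_ord1 !mxE subr0.
rewrite -(char_poly_ublock _ (row_mx 0 (\col_i c b`_i))).
apply/esym/(@char_poly_intertwine _ _ _ _ _ T).
- apply: inj_row_free => u; rewrite -[u]hsubmxK -[rsubmx u]hsubmxK TE.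
  move/eqP; rewrite rVof_eq0 // => /eqP/inj[/eqP].
  rewrite vecof_eq0 // => /eqP -> s0 t0.
  rewrite [lsubmx (rsubmx u)]mx11_scalar [rsubmx (rsubmx u)]mx11_scalar s0 t0.
  by rewrite !raddf0 !row_mx0.
- rewrite -sub1mx; apply/rV_subP => v _.
  have [x [s [t def]]] := surj (vecof b' v); apply/submxP.
  exists (row_mx (rVof b x) (row_mx s%:M t%:M)).
  by rewrite TE rVofK // !mxE mulr1n -def vecofK.
rewrite mul_block_col mul_col_mx mul_col_mx !mul_row_col !mul0mx add0r.
rewrite mul_block_col !mul0mx !add0r mul1mx mul_scalar_mx.
rewrite -/rh -/re -!rVof_app // f'h f'e linearZ /=.
congr col_mx; apply/row_matrixP => i; rewrite !rowE mulmxDr !mulmxA.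
rewrite -[_ *m I *m _]mulmxA -mxof_comp // -[_ *m I]mulmxA -mxof_comp //.
rewrite !mul_mxof vecof_delta !comp_lfunE f'iota linearD linearZ /=.
congr (_ + _).
by rewrite -mulmxA -rowE row_mul [row i _]mx11_scalar mul_scalar_mx !mxE.
Qed.

(** * Bilinearity of the bracket *)

Section LieBilinear.
Variables (K : fieldType) (n : nat) (g : {vspace 'M[K]_n}).
Implicit Types x y z : subvs_of g.

Lemma lieNC x y : lie x y = - lie y x.
Proof. by rewrite /lie -linearN; congr vsproj; rewrite /commutator opprB. Qed.

Lemma liexx x : lie x x = 0.
Proof. by rewrite /lie /commutator subrr linear0. Qed.

Lemma lieDr x y z : lie x (y + z) = lie x y + lie x z.
Proof. by have := lie_is_linear x 1 y z; rewrite !scale1r. Qed.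

Lemma lie0r x : lie x 0 = 0.
Proof. by apply: (addIr (lie x 0)); rewrite -lieDr !add0r. Qed.

Lemma lieZr x c y : lie x (c *: y) = c *: lie x y.
Proof. by have := lie_is_linear x c y 0; rewrite lie0r !addr0. Qed.

Lemma lieDl x y z : lie (x + y) z = lie x z + lie y z.
Proof. by rewrite lieNC lieDr opprD -!lieNC. Qed.

Lemma lieZl c x y : lie (c *: x) y = c *: lie x y.
Proof. by rewrite lieNC lieZr -scalerN -lieNC. Qed.

End LieBilinear.

(** * Extending a Lie algebra by two dimensions *)

Section Extension.
Variables (K : fieldType) (n n' : nat).
Variables (g : {vspace 'M[K]_n}) (g' : {vspace 'M[K]_n'}).
Local Notation L := (subvs_of g).
Local Notation L' := (subvs_of g').
Variables (iota : 'Hom(L, L')) (h e : L') (chi : 'Hom(L, K^o)).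
Hypothesis inj : forall x (s t : K),
  iota x + s *: h + t *: e = 0 -> [/\ x = 0, s = 0 & t = 0].
Hypothesis surj : forall y, exists x (s t : K), y = iota x + s *: h + t *: e.
Hypothesis iota_lie : forall x y, iota (lie x y) = lie (iota x) (iota y).
Hypothesis lie_h_iota : forall x, lie h (iota x) = 0.
Hypothesis lie_h_e : lie h e = e.
Hypothesis lie_iota_e : forall x, lie (iota x) e = (chi x : K) *: e.
Hypothesis chi_lie : forall x y, chi (lie x y) = 0.

(** All later computations in [g'] go through this formula. The scalar [chi x + s] is the weight
    with which the first element acts on [e]. *)
Lemma lie_extension x (s t : K) y (s' t' : K) :
  lie (iota x + s *: h + t *: e) (iota y + s' *: h + t' *: e) =
  iota (lie x y) + (t' * ((chi x : K) + s) - t * ((chi y : K) + s')) *: e.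
Proof.
rewrite !(lieDl, lieDr, lieZl, lieZr) !liexx lie_h_iota lie_h_e lie_iota_e.
rewrite -iota_lie [lie (iota x) h]lieNC lie_h_iota [lie e (iota y)]lieNC.
rewrite lie_iota_e [lie e h]lieNC lie_h_e oppr0 !scaler0 !addr0 !add0r.
rewrite -!scaleNr !scalerA -!addrA; congr (_ + _).
by rewrite scalerN -scaleNr -!scalerDl; congr (_ *: e); ring.
Qed.

Let embed (p : L * K^o * K^o) : L' := iota p.1.1 + (p.1.2 : K) *: h + (p.2 : K) *: e.

Let embed_linear : linear embed.
Proof.
move=> c p q; rewrite /embed /= linearP /= !scalerDl !scalerDr -!scalerA.
by rewrite -!addrA; congr (_ + _); rewrite addrCA; congr (_ + _);
   rewrite [RHS]addrCA; congr (_ + _); rewrite [RHS]addrCA.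
Qed.

(** The witness extends [F] by 0 on [h] and by 1 on [e]. It is built from the inverse of the
    coordinate map [embed]. *)
Lemma frobenius_extension : frobenius g -> frobenius g'.
Proof.
case=> F nF.
pose Em : {linear (L * K^o * K^o)%type -> L'} :=
  HB.pack embed (GRing.isLinear.Build _ _ _ _ embed embed_linear).
pose E := linfun Em.
have EE p : E p = embed p by rewrite lfunE.
have kerE : lker E == 0%VS.
  rewrite -subv0; apply/subvP => -[[x s] t]; rewrite memv_ker EE memv0.
  by move=> /eqP/inj[/= -> -> ->].
pose fst1 := linfun (fst : (L * K^o * K^o)%type -> (L * K^o)%type).
pose fst2 := linfun (fst : (L * K^o)%type -> L).
pose snd1 := linfun (snd : (L * K^o * K^o)%type -> K^o).
pose F' : 'Hom(L', K^o) := ((F \o fst2 \o fst1 + snd1) \o E^-1)%VF.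
have F'E x s t : F' (iota x + s *: h + t *: e) = F x + t.
  rewrite -[X in F' X]/(embed (x, s, t)) -EE comp_lfunE lker0_lfunK //.
  by rewrite add_lfunE !comp_lfunE !lfunE.
exists F' => X radX; have [x [s [t defX]]] := surj X.
have rad y s' t' : F (lie x y) + (t' * ((chi x : K) + s) - t * ((chi y : K) + s')) = 0.
  rewrite -(F'E _ 0) scale0r addr0 -(radX (iota y + s' *: h + t' *: e)).
  by rewrite defX lie_extension.
(* Testing a radical element against [-h], then the image of [g], then [e] kills [t], [x] and [s] in
   this order. *)
have t0 : t = 0.
  by move: (rad 0 (-1) 0); rewrite lie0r !linear0 add0r mul0r !sub0r mulrN1 opprK.
have x0 : x = 0.
  by apply: nF => y; have := rad y 0 0; rewrite t0 !mul0r subr0 addr0.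
have s0 : s = 0.
  by move: (rad 0 0 1); rewrite x0 t0 lie0r !linear0 !add0r mul1r mul0r subr0.
by rewrite defX x0 s0 t0 linear0 !scale0r !addr0.
Qed.

Lemma has_spectrum_extension S : has_spectrum g S ->
  has_spectrum g' (S `+` (msetn 1 0 `+` msetn 1 1))%mset.
Proof.
move=> specS F' nF'.
have iotaE x : iota x = iota x + 0 *: h + 0 *: e by rewrite !scale0r !addr0.
have hE : h = iota 0 + 1 *: h + 0 *: e.
  by rewrite linear0 scale0r add0r addr0 scale1r.
have eE : e = iota 0 + 0 *: h + 1 *: e.
  by rewrite linear0 scale0r !add0r scale1r.
(* Every bracket with [e] is a multiple of [e], so [F' e = 0] would put [e] in the radical. *)
have lam0 : F' e != 0.
  apply/eqP => F'e; suff /inj[_ _ /eqP] : iota 0 + 0 *: h + 1 *: e = 0.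
    by rewrite oner_eq0.
  rewrite -eE; apply: nF' => Y; have [y [s [t ->]]] := surj Y.
  by rewrite {1}eE lie_extension [lie 0 y]lieNC lie0r oppr0 linear0 add0r
             linearZ /= F'e scaler0.
(* chi vanishes on brackets, so subtracting a multiple of it does not change
   the Kirillov form; this multiple makes the component of the principal
   element of F' along iota g principal for G. *)
pose G : 'Hom(L, K^o) := ((F' \o iota) - (F' h : K) *: chi)%VF.
have GE y : G y = F' (iota y) - F' h * chi y.
  by rewrite [LHS]add_lfunE opp_lfunE scale_lfunE comp_lfunE.
have G_lie x y : G (lie x y) = F' (iota (lie x y)).
  by rewrite GE chi_lie mulr0 subr0.
(* The correction [- chi x] along [h] gives weight 0 on [e]. A radical element [x] of [G] thus
   yields a radical element of [F']. *)
have nG : frobenius_form G.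
  move=> x radx; suff /inj[] : iota x + - (chi x : K) *: h + 0 *: e = 0 by [].
  apply: nF' => Y; have [y [s [t ->]]] := surj Y.
  by rewrite lie_extension subrr mulr0 mul0r subrr scale0r addr0 -G_lie.
have [x prx mulx] := specS G nG.
(* Pairing with [e] forces weight 1, which fixes [s]; pairing with [h] reads [- t * F' e = F' h],
   which fixes [t]. *)
pose s : K := 1 - chi x; pose t : K := - (F' h / F' e).
pose X := iota x + s *: h + t *: e.
exists X => [Y|].
  have [y [s' [t' ->]]] := surj Y.
  rewrite lie_extension !linearD !linearZ /= -G_lie prx GE /s /t /GRing.scale /=.
  by field.
have adX y : ad X y = lie X y by rewrite adE.
(* The last two arguments are the [e]-components of the brackets of [X] with [iota y] and with
   [h]. *)
move=> z; rewrite (@char_poly_extension _ _ _ (ad x) (ad X) iota h e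
   (fun y => - (t * chi y)) (- t)).
- have mupX : mup z ('X : {poly K}) = (z == 0 : nat).
    by have := mup_XsubCX 1 z (0 : K); rewrite subr0 expr1 eq_sym => ->; case: eqP.
  have mup1 : mup z ('X - 1%:P : {poly K}) = (z == 1 : nat).
    by have := mup_XsubCX 1 z (1 : K); rewrite expr1 eq_sym => ->; case: eqP.
  rewrite mupM ?mulf_neq0 ?monic_neq0 ?char_poly_monic ?monicX ?monicXsubC //.
  rewrite mupM ?monic_neq0 ?monicX ?monicXsubC // mupX mup1 !msetE2 !msetnE mulx.
  by congr addn; congr addn; case: eqP.
- exact: inj.
- exact: surj.
- move=> y; rewrite !adE {1}[iota y]iotaE lie_extension.
  by rewrite mul0r sub0r addr0.
- by rewrite adE {1}hE lie_extension lie0r !linear0 !add0r mul0r sub0r mulr1.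
- by rewrite adE {1}eE lie_extension lie0r !linear0 addr0 mulr0 subr0 mul1r /s
     subrKC scale1r add0r.
Qed.

End Extension.

(** * Coordinate subspaces and the support of seaweed matrices *)

Section CoordinateSubspaces.
Variables (K : fieldType) (n : nat).
Implicit Types (P : pred 'I_n) (A : 'M[K]_n).

(** An arbitrary predicate covers [initial_span] and [final_span] at once: both are instances by
    conversion. *)
Definition coordinate_span P : {vspace 'cV[K]_n} :=
  <<[seq (delta_mx i ord0 : 'cV[K]_n) | i : 'I_n <- enum 'I_n & P i]>>%VS.

Lemma mem_coordinate_span P (v : 'cV[K]_n) :
  reflect (forall i, ~~ P i -> v i ord0 = 0) (v \in coordinate_span P).
Proof.
rewrite /coordinate_span; set X := map _ _; apply: (iffP idP) => [vX i nPi|v0].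
  rewrite (coord_span (vX : v \in <<in_tuple X>>%VS)) summxE big1 // => k _.
  have /mapP[j + ->] : X`_k \in X by rewrite mem_nth.
  rewrite mem_filter => /andP[Pj _]; rewrite !mxE andbT.
  by case: eqP nPi => [->|_ _]; rewrite ?Pj ?mulr0.
rewrite [v]matrix_sum_delta memv_suml // => i _.
rewrite big_ord1; case: (boolP (P i)) => Pi; last by rewrite v0 // scale0r mem0v.
rewrite memvZ // memv_span //; apply/mapP; exists i => //.
by rewrite mem_filter Pi mem_enum.
Qed.

(** The image of a basis vector is a column of [A], so stability says that the columns indexed by
    [P] are supported on [P]. *)
Lemma coordinate_span_stable P A :
  (forall v, v \in coordinate_span P -> A *m v \in coordinate_span P) <->
  (forall i j, A i j != 0 -> P j -> P i).
Proof.
split=> [stab i j Aij Pj|supp v /mem_coordinate_span v0].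
  apply: contraR Aij => nPi; have /stab : delta_mx j ord0 \in coordinate_span P.
    apply/mem_coordinate_span => k nPk; rewrite !mxE andbT.
    by case: eqP nPk => // ->; rewrite Pj.
  by rewrite -colE => /mem_coordinate_span/(_ i nPi); rewrite mxE => ->.
apply/mem_coordinate_span => i nPi; rewrite mxE big1 // => j _.
case: (boolP (P j)) => Pj; last by rewrite v0 ?mulr0.
case: (eqVneq (A i j) 0) => [->|/supp/(_ Pj)]; first by rewrite mul0r.
by rewrite (negPf nPi).
Qed.

End CoordinateSubspaces.

(* A position (i, j) may be nonzero in the seaweed iff it is allowed by both
   rows; indices are counted from 0. *)
Definition top_allowed (a : seq nat) (i j : nat) : Prop :=
  forall k, (k <= size a)%N -> (j < sumn (take k a))%N -> (i < sumn (take k a))%N.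

Definition bottom_allowed (b : seq nat) (i j : nat) : Prop :=
  forall k, (k <= size b)%N -> (sumn (take k b) <= j)%N -> (sumn (take k b) <= i)%N.

(** The relation lives on natural numbers, not on ordinals, so that relations for different matrix
    sizes compare without casts. *)
Definition traceless_incidence (K : fieldType) n (P : nat -> nat -> Prop)
    (g : {vspace 'M[K]_n}) : Prop :=
  forall A, A \in g <-> \tr A = 0 /\ forall i j, A i j != 0 -> P i j.

Lemma seaweed_incidence (K : fieldType) a b :
  traceless_incidence (fun i j => top_allowed a i j /\ bottom_allowed b i j)
    (seaweed K a b).
Proof.
move=> A; split=> [/mem_seaweed[trA topA botA]|[trA suppA]].
  split=> // i j Aij; split=> k lek.
    by have /coordinate_span_stable/(_ i j Aij) := topA k lek.
  by have /coordinate_span_stable/(_ i j Aij) := botA k lek.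
apply/mem_seaweed; split=> // k lek; apply/coordinate_span_stable => i j Aij.
  by have [/(_ k lek)] := suppA i j Aij.
by have [_ /(_ k lek)] := suppA i j Aij.
Qed.

(** * Adding one index and one off-diagonal position *)

Section OneVertexExtension.
Variables (K : fieldType) (n : nat).

Definition corner (A : 'M[K]_n) : 'M[K]_(n + 1) := block_mx A 0 0 0.

Lemma corner_is_linear : linear corner.
Proof.
move=> c A B; rewrite /corner scale_block_mx add_block_mx.
by rewrite !scaler0 !addr0.
Qed.
HB.instance Definition _ :=
  GRing.isLinear.Build K _ _ _ corner corner_is_linear.

Lemma corner_mul A B : corner A *m corner B = corner (A *m B).
Proof. by rewrite /corner mulmx_block !(mul0mx, mulmx0) !addr0. Qed.

(** This becomes the character [chi], with [c] equal to -1 when [l] is a sink and to 1 when it is a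
    source. *)
Definition scaled_entry (c : K) (l : 'I_n) (A : 'M[K]_n) : K^o := c * A l l.

Lemma scaled_entry_is_linear c l : linear (scaled_entry c l).
Proof.
by move=> s A B; rewrite /scaled_entry !mxE /GRing.scale /=; ring.
Qed.
HB.instance Definition _ c l :=
  GRing.isLinear.Build K _ _ _ (scaled_entry c l) (scaled_entry_is_linear c l).

(** The last entry makes the trace vanish. The matrix centralizes the corner, and its bracket
    multiplies the upper right block by n+1 and the lower left block by -(n+1). Rescaled by [k0]
    below, it becomes [h]. *)
Definition grading : 'M[K]_(n + 1) := block_mx 1%:M 0 0 (- n%:R)%:M.

Lemma corner_grading A : commutator grading (corner A) = 0.
Proof.
rewrite /commutator /grading /corner !mulmx_block !(mul0mx, mulmx0, mul1mx, mulmx1).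
by rewrite !addr0 subrr.
Qed.

Variables (g : {vspace 'M[K]_n}) (g' : {vspace 'M[K]_(n + 1)}).
Variables (P P' : nat -> nat -> Prop) (E : 'M[K]_(n + 1)) (l : 'I_n) (c : K).
Hypothesis char0 : [pchar K] =i pred0.
Hypotheses (gP : traceless_incidence P g) (g'P' : traceless_incidence P' g').
Hypotheses (g_lie : lie_closed g) (g'_lie : lie_closed g').
Hypothesis P'_old : forall i j : 'I_n, P' i j <-> P i j.
Hypothesis Prefl : forall i, P i i.
Hypothesis P'refl : forall i, P' i i.
Hypotheses (E_neq0 : E != 0) (E_ul : ulsubmx E = 0) (E_dr : drsubmx E = 0).
Hypothesis E_g' : E \in g'.
Hypothesis g'_offdiag : forall B, B \in g' -> exists t,
  B = block_mx (ulsubmx B) 0 0 (drsubmx B) + t *: E.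
Hypothesis c_neq0 : c != 0.
Hypothesis corner_E :
  forall A, A \in g -> commutator (corner A) E = (c * A l l) *: E.
Hypothesis grading_E : commutator grading E = (c * n.+1%:R) *: E.
Hypothesis entry_mul :
  forall A B, A \in g -> B \in g -> (A *m B) l l = A l l * B l l.

Lemma corner_in A : A \in g -> corner A \in g'.
Proof.
move=> /gP[trA suppA]; apply/g'P'; split.
  by rewrite /corner mxtrace_block trA mxtrace0 addr0.
move=> i j; case: (split_ordP i) => i' ->; case: (split_ordP j) => j' ->.
- by rewrite block_mxEul => /suppA/P'_old.
- by rewrite block_mxEur mxE eqxx.
- by rewrite block_mxEdl mxE eqxx.
- by rewrite block_mxEdr mxE eqxx.
Qed.

Lemma grading_in : grading \in g'.
Proof.
apply/g'P'; split.
  by rewrite /grading mxtrace_block !mxtrace_scalar mulr1n subrr.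
move=> i j; case: (split_ordP i) => i' ->; case: (split_ordP j) => j' ->.
- rewrite block_mxEul mxE; case: (eqVneq i' j') => [->|]; last by rewrite eqxx.
  by move=> _; apply/P'_old/Prefl.
- by rewrite block_mxEur mxE eqxx.
- by rewrite block_mxEdl mxE eqxx.
- by rewrite !ord1 => _; apply: P'refl.
Qed.

Let n_neq0 : n%:R != 0 :> K.
Proof. by rewrite (pcharf0P _).1 //; case: (n) l => // -[]. Qed.

Let nS_neq0 : n.+1%:R != 0 :> K.
Proof. by rewrite (pcharf0P _).1. Qed.

Let k0 := (c * n.+1%:R)^-1.
Let iota : 'Hom(subvs_of g, subvs_of g') := linfun (vsproj g' \o corner \o vsval).
Let e : subvs_of g' := vsproj g' E.
Let h : subvs_of g' := vsproj g' (k0 *: grading).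
Let chi : 'Hom(subvs_of g, K^o) := linfun (scaled_entry c l \o vsval).

Let k0_neq0 : k0 != 0.
Proof. by rewrite invr_eq0 mulf_neq0 // nS_neq0. Qed.

Let val_iota x : vsval (iota x) = corner (vsval x).
Proof. by rewrite lfunE /= vsprojK // corner_in // subvsP. Qed.

Let val_e : vsval e = E.
Proof. by rewrite vsprojK. Qed.

Let val_h : vsval h = k0 *: grading.
Proof. by rewrite vsprojK // memvZ // grading_in. Qed.

Let chiE x : chi x = c * vsval x l l.
Proof. by rewrite lfunE. Qed.

(** This instantiates the abstract extension with [e] given by [E]. The multiplicativity [entry_mul]
    makes [chi] vanish on brackets, and [g'_offdiag] reduces spanning to block-diagonal matrices. *)
Lemma frobenius_spectrum_one_vertex S : frobenius g -> has_spectrum g S ->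
  frobenius g' /\ has_spectrum g' (S `+` (msetn 1 0 `+` msetn 1 1))%mset.
Proof.
move=> frob spec.
have inj x (s t : K) : iota x + s *: h + t *: e = 0 -> [/\ x = 0, s = 0 & t = 0].
  move=> /(congr1 vsval); rewrite !linearD !linearZ /= val_iota val_h val_e.
  rewrite scalerA => eq0.
  have := eq0; rewrite -[E]submxK E_ul E_dr /corner /grading !scale_block_mx.
  rewrite !add_block_mx -block_mx0 => /eq_block_mx[ul0 _ _ dr0].
  have s0 : s = 0.
    have /eqP := congr1 (fun M : 'M_1 => M 0 0) dr0.
    rewrite !mxE mulr1n add0r mulr0 addr0 mulrN oppr_eq0 !mulf_eq0.
    by rewrite (negPf k0_neq0) (negPf n_neq0) !orbF => /eqP.
  have x0 : x = 0.
    apply: val_inj; rewrite [RHS]linear0 -ul0.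
    by rewrite s0 mul0r scale0r scaler0 !addr0.
  split=> //; apply/eqP; move: eq0; rewrite s0 x0 mul0r scale0r !linear0 !add0r.
  by move/eqP; rewrite scaler_eq0 (negPf E_neq0) orbF.
have surj y : exists x (s t : K), y = iota x + s *: h + t *: e.
  have yg' := subvsP y; have [t def_y] := g'_offdiag yg'.
  have [try suppy] := (g'P' _).1 yg'.
  set U := ulsubmx (vsval y) in def_y; set D := drsubmx (vsval y) in def_y.
  (* The lower right entry of [s *: grading] must be that of [D]. Since [y] has trace 0, what
     remains in the upper left block is then traceless. *)
  pose s := - (D 0 0 / n%:R).
  have Ag : U - s%:M \in g.
    apply/gP; split.
      have: \tr U + \tr D = 0 by rewrite -try -[vsval y]submxK mxtrace_block.
      rewrite linearB /= mxtrace_scalar [D]mx11_scalar mxtrace_scalar mulr1n.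
      by rewrite /s mulNrn opprK -[_ *+ n]mulr_natr divfK ?n_neq0 // => <-.
    move=> i j; rewrite !mxE; case: (eqVneq i j) => [-> _|_]; first exact: Prefl.
    by rewrite subr0 => /suppy/P'_old.
  exists (vsproj g (U - s%:M)), (s / k0), t; apply: val_inj.
  rewrite [RHS]linearD [in RHS]linearD !linearZ /= val_iota val_h val_e vsprojK //.
  rewrite scalerA divfK // [LHS]def_y; congr (_ + _).
  rewrite /corner /grading scale_block_mx add_block_mx !scaler0 !addr0 add0r.
  rewrite scale_scalar_mx mulr1 subrK scale_scalar_mx /s mulrNN divfK ?n_neq0 //.
  by congr block_mx; exact: mx11_scalar.
have iota_lie x y : iota (lie x y) = lie (iota x) (iota y).
  apply: val_inj; rewrite /= val_iota !val_lie // !val_iota /commutator.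
  by rewrite !corner_mul linearB.
have h_iota x : lie h (iota x) = 0.
  apply: val_inj; rewrite [RHS]linear0 /= val_lie // val_iota val_h /commutator.
  by rewrite -scalemxAl -scalemxAr -scalerBr -/(commutator _ _) corner_grading scaler0.
have h_e : lie h e = e.
  apply: val_inj; rewrite /= val_lie // val_h val_e /commutator.
  rewrite -scalemxAl -scalemxAr -scalerBr -/(commutator _ _) grading_E scalerA.
  by rewrite mulVf ?scale1r // mulf_neq0 // nS_neq0.
have iota_e x : lie (iota x) e = (chi x : K) *: e.
  apply: val_inj; rewrite [RHS]linearZ /= val_lie // val_iota val_e chiE.
  by rewrite corner_E // subvsP.
have chi_lie x y : chi (lie x y) = 0.
  rewrite chiE val_lie //.
  have -> A B : commutator A B l l = (A *m B) l l - (B *m A) l l.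
    by rewrite /commutator !mxE.
  by rewrite !entry_mul ?subvsP // [X in _ - X]mulrC subrr mulr0.
split; first exact: (@frobenius_extension _ _ _ _ _ iota h e chi).
exact: (@has_spectrum_extension _ _ _ _ _ iota h e chi).
Qed.

End OneVertexExtension.

(** * New positions at a sink or at a source *)

Section NewEdge.
Variables (K : fieldType) (n n' : nat) (l : nat).
Variables (g : {vspace 'M[K]_n}) (g' : {vspace 'M[K]_n'}).
Variables (P P' : nat -> nat -> Prop) (S : {mset K}%mset).
Hypotheses (char0 : [pchar K] =i pred0) (n'E : n' = (n + 1)%N) (ltln : (l < n)%N).
Hypotheses (gP : traceless_incidence P g) (g'P' : traceless_incidence P' g').
Hypotheses (g_lie : lie_closed g) (g'_lie : lie_closed g').
Hypothesis P'_old : forall i j, (i < n)%N -> (j < n)%N -> P' i j <-> P i j.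
Hypothesis Prefl : forall i, P i i.
Hypothesis P'refl : forall i, P' i i.

(** At a sink, row [l] of each matrix of [g] is zero off the diagonal. Hence the entry (l, l) is
    multiplicative, and right multiplication scales the matrix unit at (n, l) by it; as this is the
    subtracted term of the commutator, [c] is -1. *)
Lemma frobenius_spectrum_new_sink_edge :
  (forall j, P l j -> (j < n)%N -> j = l) ->
  (forall j, (j < n)%N -> P' n j <-> j = l) ->
  (forall i, (i < n)%N -> ~ P' i n) ->
  frobenius g -> has_spectrum g S ->
  frobenius g' /\ has_spectrum g' (S `+` (msetn 1 0 `+` msetn 1 1))%mset.
Proof.
move=> sink edge noedge frob spec; subst n'; pose o := Ordinal ltln.
have sinkE A (j : 'I_n) : A \in g -> j != o -> A o j = 0.
  move=> /gP[_ suppA] jo; apply/eqP; apply: contraNT jo => /suppA/sink.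
  by move=> /(_ (ltn_ord j)) jl; apply/eqP/val_inj.
pose d : 'rV[K]_n := delta_mx 0 o.
have dA A : A \in g -> d *m A = A o o *: d.
  move=> Ag; rewrite -rowE; apply/rowP => j; rewrite !mxE ?eqxx /=.
  by case: (eqVneq j o) => [->|jo]; [rewrite mulr1 | rewrite mulr0 sinkE].
apply: (@frobenius_spectrum_one_vertex K n g g' P P' (block_mx 0 0 d 0) o (-1)) => //.
- by move=> i j; apply: P'_old.
- apply/eqP => /(congr1 (fun M : 'M_(n + 1) => M (rshift n ord0) (lshift 1 o))) /eqP.
  by rewrite block_mxEdl !mxE !eqxx oner_eq0.
- by rewrite block_mxKul.
- by rewrite block_mxKdr.
- apply/g'P'; split; first by rewrite mxtrace_block !mxtrace0 addr0.
  move=> i j; case: (split_ordP i) => i' ->; case: (split_ordP j) => j' ->.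
  + by rewrite block_mxEul mxE eqxx.
  + by rewrite block_mxEur mxE eqxx.
  + rewrite block_mxEdl mxE ord1 eqxx /=.
    case: (eqVneq j' o) => [->|]; last by rewrite eqxx.
    by move=> _; rewrite /= addn0; apply/edge.
  + by rewrite block_mxEdr mxE eqxx.
- move=> B /g'P'[_ suppB]; exists (dlsubmx B ord0 o).
  rewrite -{1}[B]submxK scale_block_mx add_block_mx !scaler0 !addr0 !add0r.
  congr block_mx; apply/matrixP => i j; rewrite !ord1.
    apply/eqP; rewrite !mxE; apply: contraT => /suppB /=.
    by rewrite addn0 => /noedge[].
  rewrite [RHS]mxE [d 0 j]mxE eqxx /=; case: (eqVneq j o) => [->|jo].
    by rewrite mulr1.
  rewrite mulr0; apply/eqP; rewrite !mxE; apply: contraNT jo => /suppB /=.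
  by rewrite addn0 => /edge jl; apply/eqP/val_inj/jl.
- by rewrite oppr_eq0 oner_eq0.
- move=> A Ag; rewrite /commutator /corner !mulmx_block !(mul0mx, mulmx0) !addr0.
  rewrite dA // scale_block_mx opp_block_mx add_block_mx !scaler0 !oppr0 !addr0 add0r.
  by rewrite mulN1r scaleNr.
- rewrite /commutator /grading !mulmx_block !(mul0mx, mulmx0, mulmx1) !addr0 !add0r.
  rewrite scale_block_mx opp_block_mx add_block_mx !scaler0 !oppr0 !addr0.
  by rewrite mul_scalar_mx -[X in _ - X]scale1r -scalerBl -natr1 mulN1r opprD.
- move=> A B Ag Bg; rewrite mxE (bigD1 o) //= big1 ?addr0 // => j jo.
  by rewrite sinkE ?mul0r.
Qed.

(** This is the transposed situation: column [l] is zero off the diagonal, and the unit at (l, n) is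
    scaled by left multiplication, so [c] is 1. *)
Lemma frobenius_spectrum_new_source_edge :
  (forall i, P i l -> (i < n)%N -> i = l) ->
  (forall i, (i < n)%N -> P' i n <-> i = l) ->
  (forall j, (j < n)%N -> ~ P' n j) ->
  frobenius g -> has_spectrum g S ->
  frobenius g' /\ has_spectrum g' (S `+` (msetn 1 0 `+` msetn 1 1))%mset.
Proof.
move=> source edge noedge frob spec; subst n'; pose o := Ordinal ltln.
have sourceE A (i : 'I_n) : A \in g -> i != o -> A i o = 0.
  move=> /gP[_ suppA] io; apply/eqP; apply: contraNT io => /suppA/source.
  by move=> /(_ (ltn_ord i)) il; apply/eqP/val_inj.
pose d : 'cV[K]_n := delta_mx o 0.
have Ad A : A \in g -> A *m d = A o o *: d.
  move=> Ag; rewrite -colE; apply/colP => i; rewrite !mxE andbT.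
  by case: (eqVneq i o) => [->|io]; [rewrite mulr1 | rewrite mulr0 sourceE].
apply: (@frobenius_spectrum_one_vertex K n g g' P P' (block_mx 0 d 0 0) o 1) => //.
- by move=> i j; apply: P'_old.
- apply/eqP => /(congr1 (fun M : 'M_(n + 1) => M (lshift 1 o) (rshift n ord0))) /eqP.
  by rewrite block_mxEur !mxE !eqxx oner_eq0.
- by rewrite block_mxKul.
- by rewrite block_mxKdr.
- apply/g'P'; split; first by rewrite mxtrace_block !mxtrace0 addr0.
  move=> i j; case: (split_ordP i) => i' ->; case: (split_ordP j) => j' ->.
  + by rewrite block_mxEul mxE eqxx.
  + rewrite block_mxEur mxE ord1 eqxx andbT.
    case: (eqVneq i' o) => [->|]; last by rewrite eqxx.
    by move=> _; rewrite /= addn0; apply/edge.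
  + by rewrite block_mxEdl mxE eqxx.
  + by rewrite block_mxEdr mxE eqxx.
- move=> B /g'P'[_ suppB]; exists (ursubmx B o ord0).
  rewrite -{1}[B]submxK scale_block_mx add_block_mx !scaler0 !addr0 !add0r.
  congr block_mx; apply/matrixP => i j; rewrite !ord1.
    rewrite [RHS]mxE [d i 0]mxE eqxx andbT; case: (eqVneq i o) => [->|io].
      by rewrite mulr1.
    rewrite mulr0; apply/eqP; rewrite !mxE; apply: contraNT io => /suppB /=.
    by rewrite addn0 => /edge il; apply/eqP/val_inj/il.
  apply/eqP; rewrite !mxE; apply: contraT => /suppB /=.
  by rewrite addn0 => /noedge[].
- by rewrite oner_eq0.
- move=> A Ag; rewrite /commutator /corner !mulmx_block !(mul0mx, mulmx0) !addr0.
  rewrite Ad // scale_block_mx opp_block_mx add_block_mx !scaler0 !oppr0 !addr0 ?add0r.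
  by rewrite mul1r.
- rewrite /commutator /grading !mulmx_block !(mul0mx, mulmx0, mul1mx) !addr0 !add0r.
  rewrite scale_block_mx opp_block_mx add_block_mx !scaler0 !oppr0 !addr0.
  rewrite mul_mx_scalar -scaleNr opprK -[X in X + _]scale1r -scalerDl.
  by rewrite mul1r nat1r.
- move=> A B Ag Bg; rewrite mxE (bigD1 o) //= big1 ?addr0 // => j jo.
  by rewrite [B _ _]sourceE ?mulr0.
Qed.

End NewEdge.

(** * Allowed positions when a part is appended *)

(** The only new boundary is the total sum. It exceeds both indices, so it imposes nothing. *)
Lemma top_allowed_rcons a x i j : (j < sumn a + x)%N -> (i < sumn a + x)%N ->
  top_allowed (rcons a x) i j <-> top_allowed a i j.
Proof.
move=> ltj lti; split=> H k lek.
  by have := H k; rewrite size_rcons -cats1 takel_cat //; apply; apply: leqW.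
move: lek; rewrite size_rcons leq_eqVlt => /orP[/eqP ->|].
  by rewrite take_oversize ?size_rcons // sumn_rcons.
by rewrite ltnS => lek; rewrite -cats1 takel_cat //; apply: H.
Qed.

Lemma bottom_allowed_rcons b x i j : (j < sumn b + x)%N ->
  bottom_allowed (rcons b x) i j <-> bottom_allowed b i j.
Proof.
move=> ltj; split=> H k lek.
  by have := H k; rewrite size_rcons -cats1 takel_cat //; apply; apply: leqW.
move: lek; rewrite size_rcons leq_eqVlt => /orP[/eqP ->|].
  by rewrite take_oversize ?size_rcons // sumn_rcons; lia.
by rewrite ltnS => lek; rewrite -cats1 takel_cat //; apply: H.
Qed.

Lemma sumn_take_le a k : (sumn (take k a) <= sumn a)%N.
Proof. by rewrite -{2}(cat_take_drop k a) sumn_cat leq_addr. Qed.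

Lemma top_allowed_to_outside a i j : (sumn a <= j)%N -> top_allowed a i j.
Proof. by move=> lej k _; have := sumn_take_le a k; lia. Qed.

(** A row index past every boundary forces the column index past them too, and the last boundary is
    the strongest condition. *)
Lemma top_allowed_from_outside a i j : (sumn a <= i)%N ->
  top_allowed a i j <-> (sumn a <= j)%N.
Proof.
move=> lei; split=> [/(_ _ (leqnn _))|]; last exact: top_allowed_to_outside.
by rewrite take_size; lia.
Qed.

Lemma bottom_allowed_from_outside b i j : (sumn b <= i)%N -> bottom_allowed b i j.
Proof. by move=> lei k _; have := sumn_take_le b k; lia. Qed.

Lemma bottom_allowed_to_outside b i j : (sumn b <= j)%N ->
  bottom_allowed b i j <-> (sumn b <= i)%N.
Proof.
move=> lej; split=> [/(_ _ (leqnn _))|]; last exact: bottom_allowed_from_outside.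
by rewrite take_size; lia.
Qed.

(** * The two seaweed steps *)

Section Steps.
Variables (K : fieldType) (S : {mset K}%mset).
Hypothesis char0 : [pchar K] =i pred0.

(** The last top part of size 1 makes its index [sumn a] a sink. The new index joins this top part,
    which allows only the position to the sink, while its own bottom part forbids all positions from
    old rows into the new column. *)
Lemma frobenius_seaweed_top_step a b :
  frobenius_seaweed_with_spectrum (rcons a 1%N) b S ->
  frobenius_seaweed_with_spectrum (rcons a 2%N) (rcons b 1%N)
    (S `+` (msetn 1 0 `+` msetn 1 1))%mset.
Proof.
move=> [ca cb frob spec]; move: ca cb.
rewrite {1}/composition eqxx andbT all_rcons => /andP[_ posa].
rewrite /composition => /andP[posb /eqP sumb].
have sa1 : sumn (rcons a 1%N) = (sumn a + 1)%N by rewrite sumn_rcons.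
have sa2 : sumn (rcons a 2%N) = (sumn a + 1 + 1)%N by rewrite sumn_rcons; lia.
have sb1 : sumn (rcons b 1%N) = (sumn a + 1 + 1)%N by rewrite sumn_rcons sumb sa1.
have [||||||||frob' spec'] := @frobenius_spectrum_new_sink_edge K _ _ (sumn a) _ _
   (fun i j => top_allowed (rcons a 1%N) i j /\ bottom_allowed b i j)
   (fun i j => top_allowed (rcons a 2%N) i j /\ bottom_allowed (rcons b 1%N) i j)
   S char0 _ _ (@seaweed_incidence K _ _) (@seaweed_incidence K _ _)
   (@seaweed_lie_closed K _ _) (@seaweed_lie_closed K _ _) _ _ _ _ _ _ frob spec.
- by rewrite sa1 sa2.
- by rewrite sa1; lia.
- rewrite sa1 => i j lti ltj.
  by rewrite !top_allowed_rcons ?bottom_allowed_rcons //; lia.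
- by split.
- by split.
- rewrite sa1 => j [+ _] ltj; rewrite top_allowed_rcons ?top_allowed_from_outside //; lia.
- rewrite sa1 => j ltj; rewrite top_allowed_rcons ?bottom_allowed_rcons; try lia.
  rewrite top_allowed_from_outside; last lia.
  split=> [[lej _]|->]; first lia.
  by split=> //; apply: bottom_allowed_from_outside; lia.
- rewrite sa1 => i lti [_]; rewrite bottom_allowed_rcons ?bottom_allowed_to_outside; lia.
split=> //; rewrite /composition ?eqxx ?all_rcons ?posa ?posb //=.
by rewrite sb1 sa2.
Qed.

(** The last bottom part of size 1 makes [sumn b] a source. The new index shares its bottom part but
    has its own top part, so only the position from the source to it appears. *)
Lemma frobenius_seaweed_bottom_step a b :
  frobenius_seaweed_with_spectrum a (rcons b 1%N) S ->
  frobenius_seaweed_with_spectrum (rcons a 1%N) (rcons b 2%N)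
    (S `+` (msetn 1 0 `+` msetn 1 1))%mset.
Proof.
move=> [ca cb frob spec]; move: ca cb.
rewrite {1}/composition eqxx andbT => posa.
rewrite /composition all_rcons sumn_rcons => /andP[/andP[_ posb] /eqP sumb].
have sa1 : sumn (rcons a 1%N) = (sumn a + 1)%N by rewrite sumn_rcons.
have sb2 : sumn (rcons b 2%N) = (sumn a + 1)%N by rewrite sumn_rcons; lia.
have [||||||||frob' spec'] := @frobenius_spectrum_new_source_edge K _ _ (sumn b) _ _
   (fun i j => top_allowed a i j /\ bottom_allowed (rcons b 1%N) i j)
   (fun i j => top_allowed (rcons a 1%N) i j /\ bottom_allowed (rcons b 2%N) i j)
   S char0 _ _ (@seaweed_incidence K _ _) (@seaweed_incidence K _ _)
   (@seaweed_lie_closed K _ _) (@seaweed_lie_closed K _ _) _ _ _ _ _ _ frob spec.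
- by rewrite sa1.
- by rewrite -sumb; lia.
- move=> i j lti ltj.
  by rewrite !bottom_allowed_rcons ?top_allowed_rcons //; lia.
- by split.
- by split.
- move=> i [_ +] lti; rewrite bottom_allowed_rcons ?bottom_allowed_to_outside //; lia.
- move=> i lti; rewrite top_allowed_rcons ?bottom_allowed_rcons; try lia.
  rewrite bottom_allowed_to_outside; last lia.
  split=> [[_ lei]|->]; first lia.
  by split=> //; apply: top_allowed_to_outside.
- move=> j ltj [+ _]; rewrite top_allowed_rcons ?top_allowed_from_outside; lia.
split=> //; rewrite /composition ?eqxx ?all_rcons ?posa ?posb //=.
by rewrite sa1 sb2.
Qed.

End Steps.

(** * Alternating the two steps *)

Theorem mainTheorem5 (R : realType) (a b : seq nat) (S : {mset R[i]}%mset)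
    (r : nat) :
  (1 <= r)%N ->
  frobenius_seaweed_with_spectrum (a ++ [:: 1%N]) b S ->
  frobenius_seaweed_with_spectrum
    (a ++ nseq r 2%N) (b ++ nseq (r - 1)%N 2%N ++ [:: 1%N])
    (S `+` (msetn (2 * r - 1)%N 0 `+` msetn (2 * r - 1)%N 1))%mset /\
  frobenius_seaweed_with_spectrum
    (a ++ nseq r 2%N ++ [:: 1%N]) (b ++ nseq r 2%N)
    (S `+` (msetn (2 * r)%N 0 `+` msetn (2 * r)%N 1))%mset.
Proof.
have char0 : [pchar R[i]] =i pred0 by exact: Num.Theory.pchar_num.
have nseqS k : nseq k.+1 2%N = rcons (nseq k 2%N) 2%N.
  by rewrite -cats1 -(nseqD k 1) addn1.
have mset_step (k : nat) :
    ((S `+` (msetn k 0 `+` msetn k 1)) `+` (msetn 1 0 `+` msetn 1 1) =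
     S `+` (msetn k.+1 0 `+` msetn k.+1 1) :> {mset R[i]})%mset.
  by apply/msetP => z; rewrite !msetE2 !msetnE; case: (z == 0); case: (z == 1); lia.
case: r => // r _ gS.
have stage1 k : frobenius_seaweed_with_spectrum (a ++ nseq k 2%N ++ [:: 1%N])
      (b ++ nseq k 2%N) (S `+` (msetn (2 * k)%N 0 `+` msetn (2 * k)%N 1))%mset ->
    frobenius_seaweed_with_spectrum (a ++ nseq k.+1 2%N)
      (b ++ nseq k 2%N ++ [:: 1%N])
      (S `+` (msetn (2 * k).+1%N 0 `+` msetn (2 * k).+1%N 1))%mset.
  rewrite nseqS !catA !cats1 -rcons_cat -mset_step.
  exact: frobenius_seaweed_top_step.
have stage2 k : frobenius_seaweed_with_spectrum (a ++ nseq k.+1 2%N)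
      (b ++ nseq k 2%N ++ [:: 1%N])
      (S `+` (msetn (2 * k).+1%N 0 `+` msetn (2 * k).+1%N 1))%mset ->
    frobenius_seaweed_with_spectrum (a ++ nseq k.+1 2%N ++ [:: 1%N])
      (b ++ nseq k.+1 2%N)
      (S `+` (msetn (2 * k.+1)%N 0 `+` msetn (2 * k.+1)%N 1))%mset.
  rewrite mulnS !catA !cats1 (nseqS k) -(rcons_cat _ b) -(mset_step (2 * k).+1).
  exact: frobenius_seaweed_bottom_step.
have step k : frobenius_seaweed_with_spectrum (a ++ nseq k 2%N ++ [:: 1%N])
    (b ++ nseq k 2%N) (S `+` (msetn (2 * k)%N 0 `+` msetn (2 * k)%N 1))%mset.
  elim: k => [|k IH]; last exact/stage2/stage1.
  rewrite cats0; suff -> : (S `+` (msetn 0 0 `+` msetn 0 1))%mset = S by [].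
  by apply/msetP => z; rewrite !msetE2 !msetnE !if_same !addn0.
split; last exact: step.
have -> : (2 * r.+1 - 1 = (2 * r).+1)%N by lia.
by rewrite subn1; exact/stage1/step.
Qed.
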